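(* For $\mathcal I\subseteq[n]$ let $$\mathcal N^+(\mathcal I)_\alpha=\{v\in\{0,\ldots,|\mathcal I|\}:\psi_v(\mathcal I)=0\}.$$ Then for every $\theta\in\mathbb{R}^n$, $$\mathbb{P}_\theta\big(n^+(\mathcal I)\in\mathcal N^+(\mathcal I)_\alpha\ \text{for all }\mathcal I\subseteq[n]\big)\ge 1-\alpha .$$ Furthermore, the lower bounds $$\tilde\ell_\alpha^+(\mathcal I)=\min\big(\mathcal N^+(\mathcal I)_\alpha\big),\qquad \tilde\ell_\alpha^-(\mathcal I)=|\mathcal I|-\max\big(\mathcal N^+(\mathcal I)_\alpha\big)$$ satisfy, for every $\theta\in\mathbb{R}^n$, $$\mathbb{P}_\theta\Big(n^+(\mathcal I)\ge\tilde\ell_\alpha^+(\mathcal I)\ \text{and}\ n^-(\mathcal I)+n^0(\mathcal I)\ge\tilde\ell_\alpha^-(\mathcal I)\ \text{for all }\mathcal I\subseteq[n]\Big)\ge 1-\alpha .$$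
   Context: Setting. $[n]=\{1,\ldots,n\}$, $\alpha\in(0,1)$, and $\{\mathbb{P}_\theta:\theta\in\mathbb{R}^n\}$ is a family of probability laws for the data. For $\mathcal I\subseteq[n]$, $n^+(\mathcal I)$, $n^-(\mathcal I)$, $n^0(\mathcal I)$ are the numbers of $i\in\mathcal I$ with $\theta_i>0$, $\theta_i<0$, $\theta_i=0$, respectively. Orthants. For $\mathcal K\subseteq[n]$, $\Theta_{\mathcal K}=\{\theta\in\mathbb{R}^n:\theta_i>0\ \forall i\in\mathcal K,\ \theta_j\le 0\ \forall j\notin\mathcal K\}$, and the orthant hypothesis is $J_{\mathcal K}:\theta\in\Theta_{\mathcal K}$. These $2^n$ sets partition $\mathbb{R}^n$. Local tests. For each $\mathcal K\subseteq[n]$, $\psi_{\mathcal K}$ is a $\{0,1\}$-valued statistic (a test of $J_{\mathcal K}$) of level $\alpha$: $\sup_{\theta\in\Theta_{\mathcal K}}\mathbb{P}_\theta(\psi_{\mathcal K}=1)\le\alpha$. No other assumption is made on the tests. For $\mathcal I\subseteq[n]$ and $v\in\{0,\ldots,|\mathcal I|\}$, $\psi_v(\mathcal I)=\min\{\psi_{\mathcal K}:\mathcal K\subseteq[n],\ |\mathcal K\cap\mathcal I|=v\}$ is the test of $J_v(\mathcal I):n^+(\mathcal I)=v$. If $\mathcal N^+(\mathcal I)_\alpha$ is empty, $\tilde\ell^\pm_\alpha(\mathcal I)$ are given arbitrary values. *)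

(* Defs.v *)
From HB Require Import structures.
From mathcomp Require Import all_boot all_order all_algebra.
From mathcomp Require Import all_classical all_reals all_analysis.
From mathcomp Require Import measurable_realfun.

Set Implicit Arguments.
Unset Strict Implicit.
Unset Printing Implicit Defensive.

Import Order.TTheory GRing.Theory Num.Theory.
Import numFieldNormedType.Exports.

Local Open Scope classical_set_scope.
Local Open Scope ring_scope.

(* The index set [n] is 'I_n and a parameter theta in R^n is a row vector. *)

Definition nplus (R : realType) (n : nat) (theta : 'rV[R]_n)
  (I : {set 'I_n}) : nat := #|[set i in I | 0 < theta ord0 i]%SET|.

Definition nminus (R : realType) (n : nat) (theta : 'rV[R]_n)
  (I : {set 'I_n}) : nat := #|[set i in I | theta ord0 i < 0]%SET|.

Definition nzero (R : realType) (n : nat) (theta : 'rV[R]_n)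
  (I : {set 'I_n}) : nat := #|[set i in I | theta ord0 i == 0]%SET|.

Definition orthant (R : realType) (n : nat) (K : {set 'I_n}) :
    set 'rV[R]_n :=
  [set theta : 'rV[R]_n |
    (forall i, i \in K -> 0 < theta ord0 i) /\
    (forall j, j \notin K -> theta ord0 j <= 0)].

Section tests.
Context (R : realType) (d : measure_display) (T : measurableType d) (n : nat).

(* A {0,1}-valued statistic is a measurable map into bool; true is 1, i.e.
   rejection. *)
Definition has_level (P : 'rV[R]_n -> probability T R) (alpha : R)
    (K : {set 'I_n}) (phi : T -> bool) : Prop :=
  (ereal_sup [set P theta [set x | phi x = true]
             | theta in @orthant R n K] <= alpha%:E)%E.

Variable psi : {set 'I_n} -> T -> bool.

(* Minimum in bool for the order false < true. The index set is nonempty when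
   v <= #|I|, so the unit of the iterated minimum (true) plays no role. *)
Definition psi_count (v : nat) (I : {set 'I_n}) (x : T) : bool :=
  \big[Order.min/true]_(K : {set 'I_n} | #|(K :&: I)%SET| == v) psi K x.

Definition Nplus (I : {set 'I_n}) (x : T) : seq nat :=
  [seq v <- iota 0 #|I|.+1 | psi_count v I x == false].

(* The function dflt gives the arbitrary, possibly data-dependent and possibly
   infinite, value taken when Nplus I x is empty. The units #|I| and 0 of the
   iterated minimum and maximum below are inert on a nonempty Nplus I x. *)
Definition ell_plus (dflt : {set 'I_n} -> T -> \bar R)
    (I : {set 'I_n}) (x : T) : \bar R :=
  if Nplus I x == [::] then dflt I x
  else (\big[minn/#|I|]_(v <- Nplus I x) v)%:R%:E.

Definition ell_minus (dflt : {set 'I_n} -> T -> \bar R)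
    (I : {set 'I_n}) (x : T) : \bar R :=
  if Nplus I x == [::] then dflt I x
  else (#|I|%:R - (\max_(v <- Nplus I x) v)%:R)%:E.

End tests.

(* Main.v *)
(* Only the true orthant matters: the hypothesis with K the set of positive
   coordinates of theta is among those minimised over in each psi_v(I) with
   v = n^+(I), so on the event psi_K = 0, of probability at least 1 - alpha,
   all counts are covered simultaneously. *)

Require Import Defs.
From HB Require Import structures.
From mathcomp Require Import all_boot all_order all_algebra.
From mathcomp Require Import all_classical all_reals all_analysis.
From mathcomp Require Import measurable_realfun.

Set Implicit Arguments.
Unset Strict Implicit.
Unset Printing Implicit Defensive.

Import Order.TTheory GRing.Theory Num.Theory.
Import numFieldNormedType.Exports.

Local Open Scope classical_set_scope.
Local Open Scope ring_scope.

Lemma measurable_forall_fin d (T : measurableType d) (J : finType)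
    (A : J -> T -> Prop) :
  (forall j, measurable [set x | A j x]) ->
  measurable [set x | forall j, A j x].
Proof.
move=> mA.
have -> : [set x | forall j, A j x] = \bigcap_j [set x | A j x].
  by apply/seteqP; split=> x /= Ax j => [_|]; exact: Ax.
by apply: fin_bigcap_measurable => //; exact: finite_finset.
Qed.

(** There are only finitely many decision patterns [h : J -> bool], so the event is a finite union
    of fibres of the joint decision vector. This is why [Q] may be arbitrary. *)
Lemma measurable_bool_family d (T : measurableType d) (J : finType)
    (f : J -> {mfun T >-> bool}) (Q : (J -> bool) -> Prop) :
  measurable [set x | Q (f^~ x)].
Proof.
have -> : [set x | Q (f^~ x)] =
    \bigcup_(h in [set h : {ffun J -> bool} | Q h])
      [set x | forall j, f j x = h j].
  apply/seteqP; split=> x /= => [Qx|[h Qh fxE]].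
    exists [ffun j => f j x] => [|j]; last by rewrite ffunE.
    by congr Q: Qx; apply/funext => j; rewrite ffunE.
  by have -> : f^~ x = h by exact/funext.
apply: fin_bigcup_measurable => [|h _]; first exact: finite_finset.
apply: measurable_forall_fin => j.
exact: (@measurable_funPTI _ _ _ _ (f j) [set h j]).
Qed.

(** The unique [K] whose orthant contains [theta], since the orthants partition the parameter
    space. *)
Definition pos_set (R : realType) (n : nat) (theta : 'rV[R]_n) : {set 'I_n} :=
  [set i | 0 < theta ord0 i]%SET.

Lemma orthant_pos_set (R : realType) (n : nat) (theta : 'rV[R]_n) :
  orthant (pos_set theta) theta.
Proof. by split=> i; rewrite inE // -leNgt. Qed.

Lemma nplusE (R : realType) (n : nat) (theta : 'rV[R]_n) (I : {set 'I_n}) :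
  nplus theta I = #|(pos_set theta :&: I)%SET|.
Proof. by apply: eq_card => i; rewrite !inE andbC. Qed.

Lemma nplus_le (R : realType) (n : nat) (theta : 'rV[R]_n) (I : {set 'I_n}) :
  (nplus theta I <= #|I|)%N.
Proof. by rewrite nplusE subset_leq_card ?subsetIr. Qed.

Lemma nplus_compl (R : realType) (n : nat) (theta : 'rV[R]_n)
    (I : {set 'I_n}) :
  (nplus theta I + (nminus theta I + nzero theta I) = #|I|)%N.
Proof.
rewrite nplusE finset.setIC -[RHS](cardsID (pos_set theta) I); congr addn.
(* The non-positive part of [I] is cut again by strict negativity; trichotomy identifies the two
   pieces. *)
rewrite -[RHS](cardsID [set i | theta ord0 i < 0]%SET).
congr addn; apply: eq_card => i; rewrite !inE;
  by case: (i \in I); case: ltrgt0P.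
Qed.

Lemma nplus_in_Nplus (R : realType) d (T : measurableType d) (n : nat)
    (psi : {set 'I_n} -> T -> bool) (theta : 'rV[R]_n) (I : {set 'I_n}) x :
  psi (pos_set theta) x = false -> nplus theta I \in Nplus psi I x.
Proof.
move=> psi0; rewrite mem_filter mem_iota add0n ltnS nplus_le andbT /psi_count.
(* [pos_set theta] meets [I] in exactly [nplus theta I] points, so its test enters the minimum; one
   [false] term makes the minimum [false]. *)
by rewrite (bigD1 (pos_set theta)) /= ?nplusE ?psi0 ?eqxx //; case: (\big[_/_]_(_ | _) _).
Qed.

Lemma ell_plus_le (R : realType) d (T : measurableType d) (n : nat)
    (psi : {set 'I_n} -> T -> bool) (dflt : {set 'I_n} -> T -> \bar R)
    (I : {set 'I_n}) x v :
  v \in Nplus psi I x -> (ell_plus psi dflt I x <= v%:R%:E)%E.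
Proof.
(* Membership of [v] rules out the empty case, so [dflt] is never reached. *)
move=> vN; rewrite /ell_plus; case: eqP vN => [->//|_ vN].
rewrite lee_fin ler_nat; elim: (Nplus psi I x) vN => // w s IHs.
rewrite inE big_cons geq_min => /predU1P[->|/IHs ->]; first by rewrite leqnn.
by rewrite orbT.
Qed.

Lemma ell_minus_le (R : realType) d (T : measurableType d) (n : nat)
    (psi : {set 'I_n} -> T -> bool) (dflt : {set 'I_n} -> T -> \bar R)
    (I : {set 'I_n}) x v :
  v \in Nplus psi I x -> (ell_minus psi dflt I x <= (#|I|%:R - v%:R)%:E)%E.
Proof.
move=> vN; rewrite /ell_minus; case: eqP vN => [->//|_ vN].
by rewrite lee_fin lerD2l lerN2 ler_nat; exact: leq_bigmax_seq.
Qed.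

Lemma measurable_Nplus d (T : measurableType d) (n : nat)
    (psi : {set 'I_n} -> {mfun T >-> bool}) (I : {set 'I_n})
    (Q : seq nat -> Prop) :
  measurable [set x | Q (Nplus psi I x)].
Proof.
(* [Nplus] sees [x] only through the decisions [psi K x]. It is rewritten as a function of the
   pattern [b] by using constant tests on the dummy sample space [bool], evaluated at [true]. *)
exact: (measurable_bool_family psi
  (fun b => Q (Nplus (T := bool) (fun K _ => b K) I true))).
Qed.

(* Covers both lower bounds: each is a function of Nplus, except on the event
   that Nplus is empty. *)
Lemma measurable_ell_le (R : realType) d (T : measurableType d) (n : nat)
    (psi : {set 'I_n} -> {mfun T >-> bool}) (I : {set 'I_n})
    (dflt : T -> \bar R) (g : seq nat -> \bar R) (c : \bar R) :
  measurable_fun [set: T] dflt ->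
  measurable [set x | ((if Nplus psi I x == [::] then dflt x
                        else g (Nplus psi I x)) <= c)%E].
Proof.
move=> mdflt.
have -> : [set x | ((if Nplus psi I x == [::] then dflt x
                     else g (Nplus psi I x)) <= c)%E] =
    ([set x | Nplus psi I x = [::]] `&` [set x | (dflt x <= c)%E]) `|`
    [set x | Nplus psi I x <> [::] /\ (g (Nplus psi I x) <= c)%E].
  apply/seteqP; split=> x /=; case: eqP => // N0.
  - by left.
  - by right.
  - by case=> [[]|[]].
  - by case=> [[]|[]].
apply: measurableU.
- apply: measurableI; first exact: (measurable_Nplus _ _ (fun s => s = [::])).
  by rewrite -[X in measurable X]setTI; exact: emeasurable_fun_infty_c.
- exact: (measurable_Nplus _ _ (fun s => s <> [::] /\ (g s <= c)%E)).
Qed.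

(** Common reduction for both coverage statements: each event contains the acceptance event of the
    true orthant, and monotonicity of the measure transfers the bound. *)
Lemma pos_set_accept_prob (R : realType) d (T : measurableType d) (n : nat)
    (alpha : R) (P : 'rV[R]_n -> probability T R)
    (psi : {set 'I_n} -> {mfun T >-> bool}) (theta : 'rV[R]_n) (E : set T) :
  has_level P alpha (pos_set theta) (psi (pos_set theta)) ->
  measurable E -> [set x | psi (pos_set theta) x = false] `<=` E ->
  ((1 - alpha)%:E <= P theta E)%E.
Proof.
set K := pos_set theta => level mE sub.
have mrej b : measurable [set x | psi K x = b].
  exact: (@measurable_funPTI _ _ _ _ (psi K) [set b]).
have /le_trans : ((1 - alpha)%:E <= P theta [set x | psi K x = false])%E.
  have -> : [set x | psi K x = false] = ~` [set x | psi K x = true].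
    by apply/seteqP; split=> x /=; case: (psi K x).
  rewrite probability_setC // EFinB leeB //.
  (* [theta] lies in its own orthant, so its rejection probability is among those bounded by the
     supremum. *)
  apply: le_trans level; apply: ereal_sup_ubound; exists theta => //.
  exact: orthant_pos_set.
by apply; apply: le_measure => //; rewrite inE.
Qed.

Theorem proposition4p1 (R : realType) (d : measure_display)
  (T : measurableType d) (n : nat) (alpha : R)
  (P : 'rV[R]_n -> probability T R)
  (psi : {set 'I_n} -> {mfun T >-> bool})
  (dflt_plus dflt_minus : {set 'I_n} -> T -> \bar R)
  (alpha_gt0 : 0 < alpha) (alpha_lt1 : alpha < 1)
  (dflt_plus_meas : forall I : {set 'I_n},
     measurable_fun [set: T] (dflt_plus I))
  (dflt_minus_meas : forall I : {set 'I_n},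
     measurable_fun [set: T] (dflt_minus I))
  (psi_level : forall K : {set 'I_n}, has_level P alpha K (psi K)) :
  (forall theta : 'rV[R]_n,
     ((1 - alpha)%:E <=
        P theta [set x | forall I : {set 'I_n},
                           nplus theta I \in Nplus psi I x])%E) /\
  (forall theta : 'rV[R]_n,
     ((1 - alpha)%:E <=
        P theta [set x | forall I : {set 'I_n},
                   ell_plus psi dflt_plus I x <= (nplus theta I)%:R%:E /\
                   ell_minus psi dflt_minus I x
                     <= (nminus theta I + nzero theta I)%:R%:E])%E).
Proof.
(* For each event there remain its measurability and the inclusion of the acceptance event. *)
split=> theta; apply: (pos_set_accept_prob (psi_level _)).
- apply: measurable_forall_fin => I.
  exact: (measurable_Nplus _ _ (fun s => nplus theta I \in s)).
- by move=> x psi0 I; exact: nplus_in_Nplus.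
- apply: measurable_forall_fin => I; apply: measurableI.
  + exact: (measurable_ell_le psi I
      (fun s => (\big[minn/#|I|]_(v <- s) v)%:R%:E)).
  + exact: (measurable_ell_le psi I
      (fun s => (#|I|%:R - (\max_(v <- s) v)%:R)%:E)).
- move=> x psi0 I; have vN : nplus theta I \in Nplus psi I x by exact: nplus_in_Nplus.
  split; first exact: ell_plus_le.
  apply: le_trans (ell_minus_le _ vN) _.
  (* Non-positive coordinates are counted by the complement: [#|I|] minus [nplus theta I]. *)
  by rewrite -(nplus_compl theta I) natrD addrC addKr.
Qed.
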